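(* Let $G$ be a group and let $A*G$ be a crystalline $G$-graded ring. If $f$ is a nonzero central idempotent in $A*G$, then $f$ has finite support group. In particular, if $G$ is torsion-free, then every central idempotent in $A*G$ is contained in $A$.
   Context: Let $G$ be a group with identity element $e$. A ring $R$ is $G$-graded if there is a collection of additive subgroups $\{R_g\}_{g\in G}$ of $R$ such that $R=\bigoplus_{g\in G} R_g$ and $R_gR_h\subseteq R_{gh}$ for all $g,h\in G$. The support of a nonzero element $r=\sum_{g\in G} r_g$ (with $r_g\in R_g$) is the finite set $\operatorname{Supp}(r)=\{g\in G\mid r_g\neq 0\}$, and the support group of $r$ is the subgroup of $G$ generated by $\operatorname{Supp}(r)$. Crystalline graded rings (in the sense of Nauwelaerts and Van Oystaeyen): let $R$ be an associative unital ring, let $A\subseteq R$ be a subring with $1_A=1_R$, and let $u:G\to R$, $g\mapsto u_g$, be an injective map with $u_e=1_R$ and $u_g\neq 0$ for all $g\in G$. Suppose that (C1) $R=\bigoplus_{g\in G}Au_g$; (C2) for every $g\in G$, $Au_g=u_gA$ and this is a free left $A$-module of rank one with basis $u_g$; (C3) the decomposition in (C1) makes $R$ a $G$-graded ring with $R_g=Au_g$ and $R_e=A$. For $g,h\in G$ let $\alpha(g,h)\in A$ be the unique element with $u_gu_h=\alpha(g,h)u_{gh}$. Then $R$, denoted $A*G$, is called a crystalline $G$-graded ring if in addition it has no $S(G)$-torsion, where $S(G)$ is the multiplicative set generated by $\{\alpha(g,g^{-1})\mid g\in G\}$; that is, for every $g\in G$ and $a\in A$, $\alpha(g,g^{-1})a=0$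 implies $a=0$. The grading on $A*G$ is the one with $(A*G)_g=Au_g$ for $g\in G$. *)

(* Defs.v *)
From HB Require Import structures.
From mathcomp Require Import all_boot all_order all_algebra.
From mathcomp Require Import all_classical.

Set Implicit Arguments.
Unset Strict Implicit.
Unset Printing Implicit Defensive.

Import GRing.Theory.

Local Open Scope classical_set_scope.
Local Open Scope ring_scope.

Definition torsion_free (G : groupType) : Prop :=
  forall (g : G) (n : nat), (0 < n)%N -> (g ^+ n)%g = 1%g -> g = 1%g.

Definition subgroup_generated (G : groupType) (X : set G) : set G :=
  smallest [set H : set G | group_closed (mem H)] X.

Section Grading.
Variables (G : groupType) (R : pzRingType).
Implicit Types (V : G -> set R) (r : R) (c : G -> R).

(* The finiteness clause is essential: [\sum_(g \in _)] is 0 by convention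
   when infinitely many terms are nonzero. *)
Definition decomposition V r c : Prop :=
  [/\ forall g, V g (c g),
      finite_set [set g | c g != 0]
    & r = \sum_(g \in [set: G]) c g].

Definition direct_sum V : Prop := forall r, exists! c, decomposition V r c.

Definition graded V : Prop :=
  [/\ forall g, zmod_closed (mem (V g)),
      direct_sum V
    & forall (g h : G) (x y : R), V g x -> V h y -> V (g * h)%g (x * y)].

(* The default value [cst 0] is never used when [direct_sum V] holds. *)
Definition component V r : G -> R := xget (cst 0) (decomposition V r).

Definition Supp V r : set G := [set g | component V r g != 0].

Definition support_group V r : set G := subgroup_generated (Supp V r).

End Grading.

Section Crystalline.
Variables (G : groupType) (R : pzRingType).
Variables (A : set R) (u : G -> R).

Definition crystalline_part (g : G) : set R := [set a * u g | a in A].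

(* The default value 0 is never used in a crystalline graded ring, where
   [u g * u h] lies in the free module [A u_(gh)]. *)
Definition alpha (g h : G) : R :=
  xget 0 [set a | A a /\ u g * u h = a * u (g * h)%g].

Record crystalline_graded : Prop := CrystallineGraded {
  cg_subring : subring_closed (mem A);
  cg_inj : injective u;
  cg_u1 : u 1%g = 1;
  cg_neq0 : forall g, u g != 0;
  cg_direct_sum : direct_sum crystalline_part;
  cg_normal : forall g, crystalline_part g = [set u g * a | a in A];
  (* [u g] spans [A u_g] by definition, so being a basis amounts to this *)
  cg_free : forall g a, A a -> a * u g = 0 -> a = 0;
  cg_graded : graded crystalline_part;
  cg_part1 : crystalline_part 1%g = A;
  cg_torsion : forall g a, A a -> alpha g (g^-1)%g * a = 0 -> a = 0
}.

End Crystalline.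

Definition central_idempotent (R : pzRingType) (f : R) : Prop :=
  (forall x, GRing.comm f x) /\ f * f = f.

(* Main.v *)
Require Import Defs.
From HB Require Import structures.
From mathcomp Require Import all_boot all_order all_algebra.
From mathcomp Require Import all_classical.
From mathcomp Require Import zify.

(** Write a nonzero central idempotent [f] as the sum of its components [f_x],
    and let [S] be its finite support.  In a crystalline graded ring, comparing
    the components of [u_g f = f u_g] shows that [S] is stable under
    conjugation, because multiplication by [u_g] kills no nonzero homogeneous
    element: this is where the absence of torsion enters ([mul_u_eq0],
    [central_component_conj]).  It is then enough to prove that the elements of
    [S] have finite order.  By Dietzmann's lemma a finite conjugation-stable set
    of elements of finite order generates a finite group
    ([torsion_gen_finite]), and in a torsion-free group [S] is contained in
    [{1}], so that [f] is its own component of degree [1].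

    Suppose that some [z] in [S] has infinite order.  There is a weight
    [w : G -> int], additive on products of two elements of [S], with
    [w z != 0] ([exists_weight]).  Such a weight turns [f] into an idempotent
    Laurent polynomial [F = \sum_x f_x X^(w x)] that takes the value [f] at
    [X = 1] and commutes with the constant [f].  Two commuting idempotents
    satisfy [(F - f)^3 = F - f]; since [X - 1] divides [F - f], every power of
    [X - 1] does, and hence [F = f] ([idempotent_loop_constant]).  Reading off
    the coefficient of [X^(w z)] and then its component of degree [z] gives
    [f_z = 0], which is absurd ([central_idempotent_torsion]).

    The weight is found by linear algebra over the rationals.  It has to
    annihilate the relations [e_xy - e_x - e_y]; if every functional doing so
    vanished on [e_z], some positive multiple of [e_z] would be an integral
    combination of these relations, and a positive power of [z] would be trivial
    modulo commutators.  That is impossible when [z] has infinite order, because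
    the relevant commutators generate a finite group ([derived_finite]).  This
    is a form of Schur's theorem, and it follows, like [torsion_gen_finite],
    from a single argument that shortens words ([short_word]). *)

Set Implicit Arguments.
Unset Strict Implicit.
Unset Printing Implicit Defensive.

Import Order.TTheory GRing.Theory Num.Theory.

Local Open Scope classical_set_scope.
Local Open Scope ring_scope.

(** * Words in a finite conjugation-stable set *)

Lemma pigeonhole (T : eqType) (r : seq T) (h : nat -> T) :
  (forall i, h i \in r) ->
  exists i j, [/\ (i < j)%N, (j <= size r)%N & h i = h j].
Proof.
move=> hr; have : ~~ uniq (mkseq h (size r).+1).
  apply/negP => /uniq_leq_size sub.
  have /sub : {subset mkseq h (size r).+1 <= r}.
    by move=> _ /mapP[i _ ->].
  by rewrite size_mkseq ltnn.
case/(uniqPn (h 0)) => i [j []]; rewrite size_mkseq ltnS => ij jr.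
rewrite !nth_mkseq 1?ltnS // 1?ltnW // => [e|]; first by exists i, j.
exact: leq_trans ij jr.
Qed.

Section Words.
Variable G : groupType.
Implicit Types (D E c : seq G) (x y g : G).
Local Open Scope group_scope.

Definition word_product D g : Prop :=
  exists2 c, {subset c <= D} & g = \prod_(x <- c) x.

Lemma word_product1 D : word_product D 1.
Proof. by exists [::]; rewrite ?big_nil. Qed.

Lemma word_product_gen D x : x \in D -> word_product D x.
Proof. by move=> Dx; exists [:: x]; rewrite ?big_seq1 // => y /[!inE] /eqP->. Qed.

Lemma word_productM D x y :
  word_product D x -> word_product D y -> word_product D (x * y).
Proof.
move=> [c cD ->] [d dD ->]; exists (c ++ d); last by rewrite big_cat.
by move=> z; rewrite mem_cat => /orP[/cD|/dD].
Qed.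

Lemma word_productX D x n : word_product D x -> word_product D (x ^+ n).
Proof.
move=> Dx; elim: n => [|n IHn]; first exact: word_product1.
by rewrite expgS; exact: word_productM.
Qed.

Lemma word_productV D g : (forall x, x \in D -> word_product D x^-1) ->
  word_product D g -> word_product D g^-1.
Proof.
move=> DV [c + ->]; elim: c => [|x c IHc] cD.
  by rewrite big_nil invg1; exact: word_product1.
rewrite big_cons invgM; apply: word_productM.
  by apply: IHc => y yc; rewrite cD // inE yc orbT.
exact/DV/cD/mem_head.
Qed.

Lemma word_productJ D g y : (forall x, x \in D -> x ^ y \in D) ->
  word_product D g -> word_product D (g ^ y).
Proof.
move=> DJ [c cD ->]; exists [seq x ^ y | x <- c]; last first.
  by rewrite big_map conjg_prod.
by move=> _ /mapP[x /cD Dx ->]; exact: DJ.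
Qed.

(** Moving a letter [x] to the left across [y] replaces [y] by a conjugate, which
    is again a letter; copies of [x] are not affected by conjugation by [x]. *)
Lemma bring_powers_forward D x m c :
  (forall y z, y \in D -> z \in D -> y ^ z \in D) ->
  {subset c <= D} -> (m <= count_mem x c)%N ->
  exists c', [/\ {subset c' <= D}, (size c' + m = size c)%N
    & \prod_(y <- c) y = x ^+ m * \prod_(y <- c') y].
Proof.
move=> DJ; elim: c m => [|y c IHc] m cD /=.
  by rewrite leqn0 => /eqP->; exists [::]; rewrite mul1g.
have {}IHc m' := IHc m' (fun z zc => cD z (@mem_behead _ (y :: c) z zc)).
have Dy := cD y (mem_head y c).
case: m => [|m]; first by exists (y :: c); rewrite addn0 mul1g.
have [->|yx] := eqVneq y x.
  rewrite add1n ltnS => /IHc[c' [c'D sz pr]]; exists c'; split=> //.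
    by rewrite addnS sz.
  by rewrite big_cons pr mulgA -expgS.
rewrite add0n => cm; have [c' [c'D sz pr]] := IHc _ cm.
exists (y ^ (x ^+ m.+1) :: c'); split.
- move=> z; rewrite inE => /predU1P[->|/c'D//].
  have Dx : x \in D.
    by rewrite cD // inE -has_pred1 has_count (leq_trans _ cm) ?orbT.
  elim: m.+1 => [|k IHk]; first by rewrite conjg1.
  by rewrite expgSr conjgM DJ.
- by rewrite /= addSn sz.
- by rewrite !big_cons pr 2!mulgA -conjgC.
Qed.

Lemma long_word_repeats (T : eqType) (D c : seq T) n : {subset c <= D} ->
  (n * size D < size c)%N -> exists2 x, x \in D & (n < count_mem x c)%N.
Proof.
move=> cD; rewrite ltnNge => /negP H; apply: contrapT => H'; apply: H.
elim: D c cD H' => [|x D IHD] c cD H'.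
  by case: c cD {H'} => //= y c /(_ y (mem_head _ _)).
have cx : (count_mem x c <= n)%N.
  by rewrite leqNgt; apply/negP => ?; apply: H'; exists x; rewrite ?mem_head.
rewrite -(count_predC (pred1 x)) mulnS leq_add // -size_filter.
apply: IHD => [y|[y yD yn]].
  by rewrite mem_filter /= => /andP[yx /cD]; rewrite inE (negPf yx).
apply: H'; exists y; first by rewrite inE yD orbT.
apply: leq_trans yn _; rewrite count_filter; apply: sub_count => z /=.
by case/andP.
Qed.

(** The engine behind the theorems of both Dietzmann and Schur: a word longer than
    [n * size D] contains some letter [n.+1] times; gathering these copies gives
    a factor [x ^+ n.+1], which is replaced by at most [n] letters. *)
Lemma short_word D n :
  (forall x y, x \in D -> y \in D -> x ^ y \in D) ->
  (forall x, x \in D -> exists c, [/\ {subset c <= D}, (size c <= n)%N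
     & x ^+ n.+1 = \prod_(y <- c) y]) ->
  forall g, word_product D g -> exists c, [/\ {subset c <= D},
    (size c <= n * size D)%N & g = \prod_(y <- c) y].
Proof.
move=> DJ DX g [c + ->]; have [k ck] := ubnP (size c).
elim: k c ck => // k IHk c; rewrite ltnS => ck cD.
have [szc|] := leqP (size c) (n * size D); first by exists c.
case/(long_word_repeats cD) => x Dx /(bring_powers_forward DJ cD)[c' [c'D sz ->]].
have [d [dD szd ->]] := DX _ Dx.
rewrite -big_cat; apply: IHk => [|y].
  rewrite size_cat (leq_ltn_trans (leq_add szd (leqnn _))) //.
  by rewrite (leq_trans _ ck) // -sz addnC addnS.
by rewrite mem_cat => /orP[/dD|/c'D].
Qed.

Fixpoint word_values D k : seq G :=
  if k is k'.+1 then 1 :: [seq x * y | x <- D, y <- word_values D k']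
  else [:: 1].

Lemma word_valuesP D k c : {subset c <= D} -> (size c <= k)%N ->
  \prod_(x <- c) x \in word_values D k.
Proof.
elim: k c => [|k IHk] [|x c] cD //= ck; rewrite ?big_nil ?mem_head //.
rewrite big_cons inE allpairs_f ?orbT ?cD ?mem_head //; apply: IHk => // y yc.
by rewrite cD // inE yc orbT.
Qed.

Lemma word_product_finite D n :
  (forall x y, x \in D -> y \in D -> x ^ y \in D) ->
  (forall x, x \in D -> exists c, [/\ {subset c <= D}, (size c <= n)%N
     & x ^+ n.+1 = \prod_(y <- c) y]) ->
  exists r : seq G, forall g, word_product D g -> g \in r.
Proof.
move=> DJ DX; exists (word_values D (n * size D)) => g.
by case/(short_word DJ DX) => c [cD sc ->]; exact: word_valuesP.
Qed.

Definition finite_order g := exists2 n, (0 < n)%N & g ^+ n = 1.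

Lemma finite_order_powers (r : seq G) g :
  (forall i, g ^+ i \in r) -> finite_order g.
Proof.
move=> /pigeonhole[i [j [ij _ gij]]]; exists (j - i)%N; first by rewrite subn_gt0.
by rewrite expgnFr 1?ltnW // gij mulgV.
Qed.

Lemma finite_orderX g k : (0 < k)%N -> finite_order (g ^+ k) -> finite_order g.
Proof.
move=> k0 [n n0 gn]; exists (k * n)%N; first by rewrite muln_gt0 k0.
by rewrite expgnA.
Qed.

Lemma common_exponent D : (forall x, x \in D -> finite_order x) ->
  exists2 n, (0 < n)%N & forall x, x \in D -> x ^+ n = 1.
Proof.
elim: D => [|x D IHD] tD; first by exists 1%N.
have [y yD|n n0 Dn] := IHD; first by apply: tD; rewrite inE yD orbT.
have [m m0 xm] := tD x (mem_head _ _).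
exists (m * n)%N => [|y]; first by rewrite muln_gt0 m0.
rewrite inE => /predU1P[->|/Dn yn]; first by rewrite expgnA xm expg1n.
by rewrite mulnC expgnA yn expg1n.
Qed.

(** Dietzmann's lemma.  As [x ^+ n.+1 = 1] is an empty word, the shortening
    argument applies; inverses of letters are powers of letters, so the products
    of words already form a group. *)
Lemma torsion_gen_finite D :
  (forall x y, x \in D -> y \in D -> x ^ y \in D) ->
  (forall x, x \in D -> finite_order x) ->
  finite_set (subgroup_generated [set` D]).
Proof.
move=> DJ /common_exponent[[//|n] _ Dn].
have [r Dr] : exists r : seq G, forall g, word_product D g -> g \in r.
  apply: (word_product_finite (n := n)) => // x Dx.
  by exists [::]; rewrite big_nil Dn.
apply: (@sub_finite_set _ _ [set` r]); last exact: finite_seq.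
apply: subset_trans (_ : [set g | word_product D g] `<=` _); last first.
  by move=> g /Dr.
apply: smallest_sub; last by move=> x; exact: word_product_gen.
split=> [|x y]; rewrite ?inE; first exact: word_product1.
move=> Dx Dy; apply/word_productM/word_productV => // {Dx Dy}z Dz.
have -> : z^-1 = z ^+ n; last exact/word_productX/word_product_gen.
by apply: mulg1_eq; rewrite -expgS Dn.
Qed.

End Words.

(** * Commutators with a finite normal set generate a finite group *)

Section Schur.
Variables (G : groupType) (E : seq G).
Hypothesis EJ : forall x g : G, x \in E -> (x ^ g)%g \in E.
Implicit Types (x y z t g : G).
Local Open Scope group_scope.

Definition centralizes z : Prop := forall x, x \in E -> commute z x.

(** The double centralizer of [E] contains [E] and commutes with the powers
    provided by [power_centralizes]; it stands in for the subgroup generated by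
    [E]. *)
Definition double_centralizes t : Prop := forall z, centralizes z -> commute z t.

Lemma double_centralizes_gen x : x \in E -> double_centralizes x.
Proof. by move=> Ex z; exact. Qed.

Lemma double_centralizesM s t :
  double_centralizes s -> double_centralizes t -> double_centralizes (s * t).
Proof. by move=> cs ct z Ez; apply: commuteM; [exact: cs|exact: ct]. Qed.

Lemma double_centralizesV t : double_centralizes t -> double_centralizes t^-1.
Proof. by move=> ct z Ez; apply: commuteV; exact: ct. Qed.

Lemma double_centralizesJ s t :
  double_centralizes s -> double_centralizes t -> double_centralizes (s ^ t).
Proof.
move=> cs ct; apply: double_centralizesM; first exact: double_centralizesV.
exact: double_centralizesM.
Qed.

Lemma double_centralizes_prod c :
  {subset c <= E} -> double_centralizes (\prod_(x <- c) x).
Proof.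
move=> cE; rewrite big_seq; elim/big_ind: _ => [z _||x /cE].
- exact: commute1.
- exact: double_centralizesM.
- exact: double_centralizes_gen.
Qed.

(** Conjugation by [g] permutes the finite set [E], so each orbit has at most
    [size E] elements and the exponent [(size E)`!] makes it trivial on [E]. *)
Lemma power_centralizes :
  exists2 n, (0 < n)%N & forall g, centralizes (g ^+ n).
Proof.
exists (size E)`!; first exact: fact_gt0.
move=> g x Ex; apply: commute_sym.
have [i [j [ij jE]]] := pigeonhole (fun i => EJ (g ^+ i) Ex).
have /dvdnP[q ->] : (j - i %| (size E)`!)%N.
  by apply: dvdn_fact; rewrite subn_gt0 ij (leq_trans (leq_subr _ _)).
rewrite -{1}(subnK (ltnW ij)) expgnDr conjgM => /conjg_inj xJ.
rewrite mulnC expgnA; apply: commuteX.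
by rewrite /commute conjgC -xJ.
Qed.

(** The commutators [[~ x, t]] with [x] in [E] lie in the finite set of quotients
    [x^-1 * y] of elements of [E], although [t] ranges over a group that may be
    infinite. *)
Definition commutators : seq G := [seq d <- [seq x^-1 * y | x <- E, y <- E]
  | `[< exists x t, [/\ x \in E, double_centralizes t & d = x^-1 * x ^ t] >]].

Lemma commutatorsP d : d \in commutators <->
  exists x t, [/\ x \in E, double_centralizes t & d = x^-1 * x ^ t].
Proof.
rewrite mem_filter; split=> [/andP[/asboolP]//|dE]; rewrite (asboolT dE) /=.
case: dE => x [t [Ex _ ->]].
by apply: (allpairs_f (fun y z => y^-1 * z)); rewrite ?EJ.
Qed.

Lemma double_centralizes_commutators d :
  d \in commutators -> double_centralizes d.
Proof.
case/commutatorsP => x [t [/double_centralizes_gen cx ct ->]].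
by apply: double_centralizesM; [exact: double_centralizesV|
  exact: double_centralizesJ].
Qed.

Lemma commutatorsJ d t :
  d \in commutators -> double_centralizes t -> d ^ t \in commutators.
Proof.
case/commutatorsP => x [s [Ex cs ->]] ct; apply/commutatorsP.
exists (x ^ t), (s ^ t); split; [exact: EJ|exact: double_centralizesJ|].
by rewrite conjMg conjVg conjJg.
Qed.

Lemma commutatorsV d : d \in commutators -> d^-1 \in commutators.
Proof.
case/commutatorsP => x [t [Ex ct ->]]; apply/commutatorsP.
exists (x ^ t), t^-1; split; [exact: EJ|exact: double_centralizesV|].
by rewrite invgM invgK conjgK.
Qed.

(** Schur's identity: once a power of a commutator [d] commutes with [t], the
    next power is a product with one factor fewer than its exponent.  With [n]
    fixed by [power_centralizes], it writes [d ^+ n.+2] with [n.+1] letters. *)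
Lemma commutator_power x t n : commute (([~ x, t]) ^+ n.+1) t ->
  [~ x, t] ^+ n.+2 = [~ x, t * t] * ([~ x, t] ^ t) ^+ n.
Proof.
set d := [~ x, t] => ct.
have xt : x ^ t = x * d by rewrite /d commgEl mulVKg.
transitivity (x^-1 * (t^-1 * (x * d * t)) * (t^-1 * (d ^+ n * t))).
  have {xt} dE : d = x^-1 * (t^-1 * (x * t)) by rewrite -(mulKg x d) -xt conjgE.
  move: d dE ct => d dE ct.
  rewrite -!mulgA mulVKg (mulgA d) -expgS ct expgS {1}dE.
  by rewrite -!mulgA.
by rewrite -[t^-1 * (d ^+ n * t)]conjgE conjXg -xt commgEl conjgM.
Qed.

Lemma derived_finite :
  exists r : seq G, forall g, word_product commutators g -> g \in r.
Proof.
have [[//|n] _ nE] := power_centralizes.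
apply: (word_product_finite (n := n.+1)) => [d d' Dd Dd'|d Dd].
  exact/commutatorsJ/double_centralizes_commutators.
have /commutatorsP[x [t [Ex ct dE]]] := Dd.
exists ([~ x, t * t] :: nseq n (d ^ t)); split.
- move=> y; rewrite inE => /predU1P[->|/nseqP[-> _]]; last exact: commutatorsJ.
  apply/commutatorsP; exists x, (t * t); split=> //.
  exact: double_centralizesM.
- by rewrite /= size_nseq.
rewrite big_cons big_nseq iter_mulg_1 dE; apply: commutator_power.
by apply: ct; rewrite commgEl -dE; exact: nE.
Qed.
(** Congruence modulo the finite group generated by the commutators, which is
    normalized by the double centralizer. *)
Definition cong x y : Prop := word_product commutators (x^-1 * y).

Lemma cong_refl x : cong x x.
Proof. by rewrite /cong mulVg; exact: word_product1. Qed.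

Lemma cong_sym x y : cong x y -> cong y x.
Proof.
move=> xy; have yx : y^-1 * x = (x^-1 * y)^-1 by rewrite invgM invgK.
rewrite /cong yx; apply: word_productV => //.
by move=> d /commutatorsV; exact: word_product_gen.
Qed.

Lemma cong_trans y x z : cong x y -> cong y z -> cong x z.
Proof.
move=> xy /(word_productM xy); congr word_product.
by rewrite -mulgA mulVKg.
Qed.

Lemma congMl z x y : cong x y -> cong (z * x) (z * y).
Proof. by rewrite /cong invgM -mulgA mulKg. Qed.

Lemma congMr z x y : double_centralizes z -> cong x y -> cong (x * z) (y * z).
Proof.
move=> cz xy; rewrite /cong invgM -mulgA [x^-1 * _]mulgA.
by apply: word_productJ xy => d /commutatorsJ; exact.
Qed.

Lemma congC x t : x \in E -> double_centralizes t -> cong (t * x) (x * t).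
Proof.
move=> Ex ct; rewrite /cong invgM -mulgA.
by apply/word_product_gen/commutatorsP; exists x, t.
Qed.

Lemma cong_perm a b : {subset a <= E} -> perm_eq a b ->
  cong (\prod_(x <- a) x) (\prod_(x <- b) x).
Proof.
elim: a b => [|x a IHa] b aE.
  by rewrite perm_sym => /perm_nilP->; exact: cong_refl.
move=> ab; have bE y : y \in b -> y \in E by rewrite -(perm_mem ab) => /aE.
have xb : x \in b by rewrite -(perm_mem ab) mem_head.
case/splitPr: xb ab bE => b1 b2 ab bE; rewrite big_cat !big_cons /=.
have aE' : {subset a <= E} by move=> y ya; rewrite aE // inE ya orbT.
have /(IHa _ aE') : perm_eq a (b1 ++ b2).
  by rewrite -(perm_cons x) (permPl ab) -[x :: b2]cat1s perm_catCA.
rewrite big_cat /= => /(congMl x); move/cong_trans; apply; apply: cong_sym.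
rewrite !mulgA; apply: congMr.
  by apply: double_centralizes_prod => y yb; rewrite bE // mem_cat inE yb !orbT.
apply: congC; first by rewrite bE // mem_cat mem_head orbT.
by apply: double_centralizes_prod => y yb; rewrite bE // mem_cat yb.
Qed.

Lemma cong_torsion x y : cong (x * y) x -> finite_order y.
Proof.
case: derived_finite => r Nr xy.
have {xy} Ny : word_product commutators y.
  have := cong_sym xy; by rewrite /cong mulKg.
by apply: (finite_order_powers (r := r)) => i; exact/Nr/word_productX.
Qed.

Local Close Scope group_scope.

(** * Weights on a finite normal set *)

Definition count_row (a : seq G) : 'rV[rat]_(size E) :=
  \row_i (count_mem (nth 1%g E i) a)%:R.

Lemma count_row_cat a b : count_row (a ++ b) = count_row a + count_row b.
Proof. by apply/rowP => i; rewrite !mxE count_cat natrD. Qed.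

(** The additive shadow of the multiplicative relations between elements of [E].
    Differences of words are used so that no inverse of a letter is needed and
    the relations form a group. *)
Definition word_relation (v : 'rV[rat]_(size E)) : Prop := exists a b,
  [/\ {subset a <= E}, {subset b <= E},
    cong (\prod_(x <- a) x)%g (\prod_(x <- b) x)%g & v = count_row a - count_row b].

Lemma word_relation0 : word_relation 0.
Proof. by exists [::], [::]; split=> //; [exact: cong_refl|rewrite subrr]. Qed.

Lemma word_relationN v : word_relation v -> word_relation (- v).
Proof.
move=> [a [b [aE bE ab ->]]]; exists b, a.
by split=> //; [exact: cong_sym|rewrite opprB].
Qed.

Lemma word_relationD v w :
  word_relation v -> word_relation w -> word_relation (v + w).
Proof.
move=> [a [b [aE bE ab ->]]] [c [d [cE dE cd ->]]].
exists (a ++ c), (b ++ d); split=> [x|x||].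
- by rewrite mem_cat => /orP[/aE|/cE].
- by rewrite mem_cat => /orP[/bE|/dE].
- rewrite !big_cat /=; apply: cong_trans (congMl _ cd).
  by apply: congMr => //; exact: double_centralizes_prod.
- by rewrite !count_row_cat opprD addrACA.
Qed.

Lemma word_relationMz v (z : int) : word_relation v -> word_relation (v *~ z).
Proof.
move=> rv; have rn n : word_relation (v *+ n).
  elim: n => [|n IHn]; first exact: word_relation0.
  by rewrite mulrS; exact: word_relationD.
by case: z => n; [exact: rn | exact/word_relationN/rn].
Qed.

(** If [k] copies of [s] account for the difference of two congruent words, then,
    up to the order of the letters, one word is the other one followed by
    [s ^+ k]; hence [s ^+ k] is congruent to [1], so it lies in a finite group. *)
Lemma word_relation_torsion s k : s \in E -> (0 < k)%N ->
  word_relation (count_row [:: s] *+ k) -> finite_order s.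
Proof.
move=> Es k0 [a [b [aE bE ab cab]]]; apply: (finite_orderX k0).
have pab : perm_eq a (b ++ nseq k s).
  apply/allP => x xab; have Ex : x \in E.
    move: xab; rewrite !mem_cat => /or3P[/aE|/bE|/nseqP[->]] //.
  rewrite /= count_cat count_nseq.
  move/rowP/(_ (Ordinal (etrans (index_mem x E) Ex))): cab.
  rewrite mulmxnE !mxE nth_index //= addn0 -mulrnA => /eqP.
  by rewrite eq_sym subr_eq addrC -natrD eqr_nat.
apply: (cong_torsion (x := (\prod_(x <- b) x)%g)).
apply: cong_trans ab; apply: cong_sym.
by have := cong_perm aE pab; rewrite big_cat big_nseq iter_mulg_1.
Qed.

Lemma common_denominator (I : finType) (a : I -> rat) :
  exists2 k, (0 < k)%N & exists z : I -> int, forall i, a i *+ k = (z i)%:~R.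
Proof.
exists (\prod_i `|denq (a i)|)%N.
  by rewrite prodn_gt0 // => i; rewrite absz_gt0 denq_neq0.
exists (fun i => numq (a i) *+ (\prod_(j | j != i) `|denq (a j)|)) => i.
rewrite (bigD1 i) //= mulrnA (pmulrn (a i)) absz_denq -mulrzr -numqE.
by rewrite rmorphMn.
Qed.

(** Either [s] lies in the rational span of the relations, and then a multiple of
    it is a relation, so [s] has finite order; or a column of the cokernel of the
    matrix of relations is a functional that annihilates them but not [s], and
    clearing its denominators gives the weight. *)
Lemma exists_weight s : s \in E -> ~ finite_order s ->
  exists2 w : G -> int, w s != 0 & forall x y, x \in E -> y \in E ->
    (x * y)%g \in E -> w (x * y)%g = w x + w y.
Proof.
move=> Es ns; pose e i := nth 1%g E i.
(* Pairs whose product leaves [E] impose no condition. *)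
pose rel (p : 'I_(size E) * 'I_(size E)) : 'rV[rat]_(size E) :=
  if (e p.1 * e p.2)%g \in E
  then count_row [:: (e p.1 * e p.2)%g] - count_row [:: e p.1; e p.2] else 0.
pose B := \matrix_(i < #|{: 'I_(size E) * 'I_(size E)}|) rel (enum_val i).
have relP p : word_relation (rel p).
  rewrite /rel; case: ifP => [Epq|_]; last exact: word_relation0.
  exists [:: (e p.1 * e p.2)%g], [:: e p.1; e p.2]; split=> //.
  - by move=> x /[!inE] /eqP->.
  - by move=> x /[!inE] /pred2P[]->; exact: mem_nth.
  - by rewrite !big_cons !big_nil /= !mulg1; exact: cong_refl.
(* Clearing denominators turns a rational combination of relations into a
   relation for a positive multiple of [s]. *)
have : ~~ (count_row [:: s] <= B)%MS.
  apply/negP => /submxP[D sD]; apply: ns.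
  have [k k0 [z Dz]] := common_denominator (D 0).
  apply: (word_relation_torsion Es k0); rewrite sD mulmx_sum_row -sumrMnl.
  elim/big_ind: _ => [|v w|i _]; first exact: word_relation0.
    exact: word_relationD.
  rewrite scalerMnl Dz rowK scaler_int; exact: word_relationMz.
rewrite submxE => /rV0Pn[j]; set C := cokermx B => sCj.
have [k k0 [z Cz]] := common_denominator (C ^~ j).
pose w g := \sum_i z i *+ (e i == g).
have wE g : (w g)%:~R = (count_row [:: g] *m C) 0 j *+ k.
  rewrite /w rmorph_sum mxE -sumrMnl; apply: eq_bigr => i _ /=.
  by rewrite mxE /= addn0 rmorphMn /= -Cz mulr_natl mulrnAC eq_sym.
exists w => [|x y Ex Ey Exy].
  by rewrite -(intr_eq0 rat) wE mulrn_eq0 negb_or -lt0n k0.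
apply: (@intr_inj rat); rewrite rmorphD /= !wE -mulrnDl; congr (_ *+ _).
have relC p : rel p *m C = 0.
  have <- : row (enum_rank p) B = rel p by rewrite rowK enum_rankK.
  by rewrite -row_mul mulmx_coker row0.
have := relC (Ordinal (etrans (index_mem x E) Ex),
              Ordinal (etrans (index_mem y E) Ey)).
rewrite /rel /e /= !nth_index // Exy mulmxBl => /eqP.
rewrite subr_eq0 => /eqP->.
by rewrite -[[:: x; y]]/([:: x] ++ [:: y]) count_row_cat mulmxDl mxE.
Qed.

End Schur.

(** * Idempotent Laurent polynomials *)

Section LaurentIdempotent.
Variable R : nzRingType.
Implicit Types (p q e P Q : {poly R}) (M n : nat).

Lemma comm_XsubC1 p M : GRing.comm p (('X - 1%:P) ^+ M).
Proof. by apply/commrX/commrB; [exact: commr_polyX | exact: commr1]. Qed.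

(** [X - 1] and [X] are coprime over any ring: the constant term of
    [(X - 1)^M] is a unit, so [X] must divide the cofactor [q]. *)
Lemma divide_XsubC1_exp M n q e : q * ('X - 1%:P) ^+ M = e * 'X^n ->
  exists q', e = q' * ('X - 1%:P) ^+ M.
Proof.
elim: n q e => [|n IHn] q e; first by rewrite mulr1; exists q.
rewrite exprSr mulrA => qe.
have /factor_theorem[q' qE] : root q 0.
  have := congr1 (fun p => p`_0) qe; rewrite !coef0M coefX mulr0 => /eqP.
  rewrite rootE horner_coef0 mulIr_eq0 //.
  have -> : (('X - 1%:P) ^+ M : {poly R})`_0 = (-1) ^+ M.
    elim: M {qe IHn} => [|M IHM]; first by rewrite coef1.
    by rewrite !exprS coef0M IHM coefB coefX coefC sub0r.
  by apply/rregX/rregN/rreg1.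
apply: (IHn q'); apply: (monic_rreg (monicX R)).
by rewrite -qe qE subr0 -!mulrA (commr_polyX (_ ^+ M)).
Qed.

(** This is [(F - f)^3 = F - f] for the commuting idempotents [F = P / X^n] and
    [f = Q / X^n], with denominators cleared. *)
Lemma cube_sub P Q n : P * P = P * 'X^n -> Q * Q = Q * 'X^n -> P * Q = Q * P ->
  (P - Q) * (P - Q) * (P - Q) = (P - Q) * 'X^n * 'X^n.
Proof.
have XC p := commr_polyXn p n.
move: 'X^n XC => T XC PP QQ PQ.
have e2 : (P - Q) * (P - Q) = (P + Q) * T - (P * Q) *+ 2.
  rewrite mulrBl !mulrBr PP QQ -PQ opprB mulrDl mulr2n opprD.
  by rewrite addrACA.
have PQe : P * Q * (P - Q) = 0.
  by rewrite mulrBr {1}PQ -!mulrA PP QQ (mulrA Q) (mulrA P) PQ subrr.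
rewrite e2 mulrBl mulrnAl PQe mul0rn subr0 -[LHS]mulrA -(XC (P - Q)).
rewrite mulrA mulrDl !mulrBr; congr (_ * T).
by rewrite PP QQ -PQ addrA subrK mulrBl.
Qed.

(** The hypotheses say that [F = P / X^n] is an idempotent Laurent polynomial with
    [F(1) = f], commuting with [f].  The difference [F - f] equals its own cube
    and vanishes at [1], so it is divisible by every power of [X - 1]; comparing
    sizes, it is zero. *)
Lemma idempotent_loop_constant (f : R) P n : f * f = f ->
  P * P = P * 'X^n -> GRing.comm P f%:P -> P.[1] = f -> P = f%:P * 'X^n.
Proof.
move=> ff PP Pf P1; apply/eqP; rewrite -subr_eq0; set e := P - _.
have eee : e * e * e = e * 'X^n * 'X^n.
  apply: cube_sub => //.
    rewrite -mulrA [in LHS](mulrA 'X^n) -(commr_polyXn f%:P) !mulrA -polyCM.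
    by rewrite ff.
  by rewrite mulrA Pf -!mulrA (commr_polyXn P).
have e1 : root e 1.
  by rewrite rootE hornerD hornerN hornerCM hornerXn expr1n P1 mulr1 subrr.
(* If [Y = X - 1] divides [e] to the power [M.+1], it divides [e * e * e] to a
   higher power, and the powers of [X] in [eee] are coprime to [Y]. *)
have div M : exists q, e = q * ('X - 1%:P) ^+ M.+1.
  elim: M => [|M [q eq]]; first by case/factor_theorem: e1 => q ->; exists q.
  apply: (@divide_XsubC1_exp _ (n + n) (e * q * q * ('X - 1%:P) ^+ M)).
  rewrite exprD mulrA -eee -[RHS]mulrA.
  have -> : e * e = q * q * (('X - 1%:P) ^+ M.+1 * ('X - 1%:P) ^+ M.+1).
    by rewrite {}eq -!mulrA; congr (q * _); rewrite !mulrA -comm_XsubC1.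
  by rewrite -!mulrA -!exprD; congr (_ * (_ * (_ * _ ^+ _))); rewrite addSnnS.
apply/negPn/negP => e0; have [q eq] := div (size e).
have q0 : q != 0 by apply: contraNneq e0 => q0; rewrite eq q0 mul0r.
have Y1 : ('X - 1%:P : {poly R}) ^+ (size e).+1 \is monic.
  exact/monic_exp/monicXsubC.
have := size_Mmonic q0 Y1; rewrite -eq size_exp_XsubC addnS /= => sz.
by have := leq_addl (size q) (size e).+1; rewrite -sz ltnn.
Qed.

End LaurentIdempotent.
Lemma big_pred1_uniq (W : nmodType) (I : eqType) (r : seq I) (i : I)
    (F : I -> W) : uniq r -> i \in r -> \sum_(j <- r | j == i) F j = F i.
Proof.
move=> ur ir; rewrite big_mkcond (bigD1_seq i) //= eqxx big1 ?addr0 // => j.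
by move/negPf->.
Qed.

(** The family [c] stands for the components of the idempotent [f], listed along a
    finite set [K] of degrees, and the weight [w] need only be additive on the
    degrees that occur.  Adding [d] to the exponents makes them natural numbers:
    [\sum_x c x X^(w x)] becomes [P / X^d]. *)
Lemma weighted_idempotent_nz (G : groupType) (R : nzRingType) (K : seq G)
    (c : G -> R) (w : G -> int) :
  let f := \sum_(x <- K) c x in
  f * f = f -> (forall x, GRing.comm (c x) f) ->
  (forall k, c k = \sum_(x <- K) \sum_(y <- K | (x * y)%g == k) c x * c y) ->
  uniq K -> (forall x y, c x != 0 -> c y != 0 ->
    (x * y)%g \in K /\ w (x * y)%g = w x + w y) ->
  forall k, k != 0 -> \sum_(x <- K | w x == k) c x = 0.
Proof.
move=> f ff cf cc uK cw k k0.
pose d := (\sum_(x <- K) `|w x|)%N.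
pose n x := absz (w x + d%:Z); pose m x := absz (w x + (d + d)%N%:Z).
have wd x : x \in K -> 0 <= w x + d%:Z.
  move=> Kx; have : (`|w x| <= d)%N by rewrite /d (bigD1_seq x) //= leq_addr.
  lia.
have nE x : x \in K -> (n x)%:Z = w x + d%:Z by move=> /wd ?; rewrite gez0_abs.
have mE x : x \in K -> m x = (n x + d)%N.
  move=> Kx; apply/eqP; rewrite -eqz_nat PoszD nE // gez0_abs PoszD addrA //.
  by rewrite addr_ge0 ?wd.
have [/hasP[z Kz /eqP wz]|] := boolP (has (fun x => w x == k) K); last first.
  by move=> ?; rewrite big_hasC.
pose P := \sum_(x <- K) (c x)%:P * 'X^(n x).
have PE : P = f%:P * 'X^d.
  apply: idempotent_loop_constant => //.
  - rewrite {1 2}/P big_distrlr /=.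
    transitivity (\sum_(x <- K) \sum_(y <- K)
       (c x * c y)%:P * 'X^(m (x * y)%g)).
      apply: eq_big_seq => x Kx.
      apply: eq_big_seq => y Ky.
      have [->|cx] := eqVneq (c x) 0; first by rewrite !(mul0r, polyC0).
      have [->|cy] := eqVneq (c y) 0; first by rewrite !(mul0r, mulr0, polyC0).
      have [Kxy wxy] := cw x y cx cy.
      rewrite mulrA -[_ * _ * (c y)%:P]mulrA -(commr_polyXn (c y)%:P).
      rewrite mulrA -polyCM -mulrA -exprD; congr (_ * 'X^_).
      apply/eqP; rewrite -eqz_nat mE // !PoszD !nE // wxy.
      lia.
    transitivity (\sum_(z <- K) (c z)%:P * 'X^(m z)); last first.
      rewrite mulr_suml; apply: eq_big_seq => x Kx.
      by rewrite mE // exprD mulrA.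
    (* The degrees [x * y] of nonzero products lie in [K], so grouping the
       products by degree recovers the components of [f]. *)
    transitivity (\sum_(z <- K) \sum_(x <- K) \sum_(y <- K)
       (if (x * y)%g == z then (c x * c y)%:P * 'X^(m (x * y)%g) else 0)).
      rewrite [RHS]exchange_big; apply: eq_bigr => x _ /=.
      rewrite [RHS]exchange_big; apply: eq_bigr => y _ /=.
      have [->|cx] := eqVneq (c x) 0.
        by rewrite mul0r polyC0 mul0r big1 // => z' _; case: ifP.
      have [->|cy] := eqVneq (c y) 0.
        by rewrite mulr0 polyC0 mul0r big1 // => z' _; case: ifP.
      have [Kxy wxy] := cw x y cx cy.
      rewrite (bigD1_seq (x * y)%g) //= eqxx big1 ?addr0 // => z' /negPf.
      by rewrite eq_sym => ->.
    apply: eq_bigr => z' _; rewrite [in RHS]cc raddf_sum mulr_suml.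
    apply: eq_bigr => x _; rewrite raddf_sum mulr_suml [RHS]big_mkcond.
    by apply: eq_bigr => y _; case: eqP => // ->.
  - apply: commr_sym; apply: commr_sum => x _; apply: commrM.
      by rewrite /GRing.comm -!polyCM (cf x).
    exact: commr_polyXn.
  - rewrite horner_sum; apply: eq_bigr => x _.
    by rewrite hornerCM hornerXn expr1n mulr1.
have := congr1 (fun p : {poly R} => p`_(n z)) PE.
rewrite coefCM coefXn -eqz_nat nE // wz -subr_eq0 addrK (negPf k0) mulr0.
rewrite coef_sum => Pz0; rewrite -[RHS]Pz0 big_mkcond /=.
apply: eq_big_seq => x Kx; rewrite coefCM coefXn -eqz_nat !nE // wz.
by rewrite (inj_eq (addIr _)) eq_sym; case: eqP; rewrite (mulr1, mulr0).
Qed.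

(** Polynomials are formed over nonzero rings; over the zero ring the claim is
    trivial. *)
Lemma weighted_idempotent (G : groupType) (R : pzRingType) (K : seq G)
    (c : G -> R) (w : G -> int) :
  let f := \sum_(x <- K) c x in
  f * f = f -> (forall x, GRing.comm (c x) f) ->
  (forall k, c k = \sum_(x <- K) \sum_(y <- K | (x * y)%g == k) c x * c y) ->
  uniq K -> (forall x y, c x != 0 -> c y != 0 ->
    (x * y)%g \in K /\ w (x * y)%g = w x + w y) ->
  forall k, k != 0 -> \sum_(x <- K | w x == k) c x = 0.
Proof.
have [R0|R1] := eqVneq (1 : R) 0.
  by move=> *; rewrite -[LHS]mulr1 R0 mulr0.
pose R' : nzRingType := HB.pack R (GRing.PzSemiRing_isNonZero.Build R R1).
exact: (@weighted_idempotent_nz G R' K c w).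
Qed.

(** * Central idempotents in graded rings *)

Lemma fsum_setT (W : nmodType) (I : choiceType) (r : seq I) (F : I -> W) :
  uniq r -> (forall i, i \notin r -> F i = 0) ->
  \sum_(i \in [set: I]) F i = \sum_(i <- r) F i.
Proof.
move=> ur F0; rewrite (fsbigE r) //; last by move=> i _; exact: F0.
by apply: eq_bigl => i; exact: in_setT.
Qed.

Section Graded.
Variables (G : groupType) (R : pzRingType) (V : G -> set R).
Hypothesis gV : graded V.

Lemma componentP r : decomposition V r (component V r).
Proof.
case: gV => _ dV _; rewrite /component.
by have [c [Vc _]] := dV r; case: xgetP => [c' -> //|/(_ c)].
Qed.

Lemma componentV r g : V g (component V r g).
Proof. by case: (componentP r). Qed.

Lemma component_unique r c : decomposition V r c -> component V r = c.
Proof.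
case: gV => _ dV _ rc; have [c' [_ cu]] := dV r.
by rewrite -(cu _ rc) (cu _ (componentP r)).
Qed.

(** The components of a finite sum of homogeneous elements, whose degrees may
    repeat, are found by collecting the terms of equal degree. *)
Lemma component_sum (s : seq (G * R)) k : (forall p, p \in s -> V p.1 p.2) ->
  component V (\sum_(p <- s) p.2) k = \sum_(p <- s | p.1 == k) p.2.
Proof.
move=> sV; pose c g := \sum_(p <- s | p.1 == g) p.2.
suff /component_unique -> : decomposition V (\sum_(p <- s) p.2) c by [].
have c0 g : g \notin undup (unzip1 s) -> c g = 0.
  rewrite mem_undup => sg.
  rewrite /c big_seq_cond big1 // => p /andP[sp /eqP pg].
  by move/negP: sg; case; rewrite -pg map_f.
split=> [g||].
- have [zV _ _] := gV; have [V0 VB] := zV g.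
  rewrite /c big_seq_cond.
  elim/big_ind: _ => [|x y Vx Vy|p /andP[/sV + /eqP<-]] //.
    by have := V0; rewrite inE.
  have VD := GRing.zmod_closedD (zV g).
  by have := VD.2 x y; rewrite !inE; apply.
- apply: (@sub_finite_set _ _ [set` undup (unzip1 s)]); last exact: finite_seq.
  by move=> g /= cg; apply: contraNT cg => /c0->.
- rewrite (fsum_setT (undup_uniq (unzip1 s)) c0).
  rewrite (exchange_big_dep xpredT) //=; apply: eq_big_seq => p sp.
  under eq_bigl do rewrite eq_sym.
  by rewrite big_pred1_uniq ?undup_uniq // mem_undup map_f.
Qed.

Lemma component_indexed (I : Type) (s : seq I) (d : I -> G) (x : I -> R) k :
  (forall i, V (d i) (x i)) ->
  component V (\sum_(i <- s) x i) k = \sum_(i <- s | d i == k) x i.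
Proof.
move=> dV; have := @component_sum [seq (d i, x i) | i <- s] k.
rewrite !big_map /=; apply=> p.
elim: s => //= i s IHs; rewrite inE => /predU1P[->|/IHs//]; exact: dV.
Qed.

Lemma component0 k : component V 0 k = 0.
Proof. by have := @component_sum [::] k; rewrite !big_nil; apply. Qed.

Lemma component_support f : exists s : seq G, [/\ uniq s,
  forall x, (x \in s) = (component V f x != 0)
  & f = \sum_(x <- s) component V f x].
Proof.
have [_ fin fE] := componentP f; have /finite_seqP[s sE] := fin.
have sP x : (x \in undup s) = (component V f x != 0).
  have [cs sc] : ([set g | component V f g != 0] x) <-> ([set` s] x).
    by rewrite sE.
  by rewrite mem_undup; apply/idP/idP => [/sc|/cs].
exists (undup s); split=> //; first exact: undup_uniq.
rewrite {1}fE; apply: fsum_setT => [|x]; first exact: undup_uniq.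
by rewrite sP negbK => /eqP.
Qed.

(** The weight is taken on [S] together with the products of two elements of [S],
    where [S] is the support: this is a finite normal set on which all the
    equations [w (x * y) = w x + w y] with [x] and [y] in [S] make sense. *)
Lemma central_idempotent_torsion f : central_idempotent f ->
  (forall x g, component V f x != 0 -> component V f (x ^ g)%g != 0) ->
  forall x, component V f x != 0 -> finite_order x.
Proof.
move=> [fC ff] fJ z fz; apply: contrapT => nz.
have [_ _ fE] := componentP f; have [s [_ sP _]] := component_support f.
set c := component V f in fE fJ fz sP *.
pose E := s ++ [seq (x * y)%g | x <- s, y <- s].
have EJ x g : x \in E -> (x ^ g)%g \in E.
  rewrite !mem_cat => /orP[|/allpairsP[[a b] [sa sb ->]]].
    by rewrite !sP => cx; rewrite fJ.
  by apply/orP; right; rewrite conjMg allpairs_f // sP fJ // -sP.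
have Ez : z \in E by rewrite mem_cat sP fz.
have [w wz wM] := exists_weight EJ Ez nz.
pose K := undup E.
have fK : f = \sum_(x <- K) c x.
  rewrite fE; apply: fsum_setT => [|x]; first exact: undup_uniq.
  by rewrite mem_undup mem_cat sP negb_or negbK => /andP[/eqP].
have cz : \sum_(x <- K | w x == w z) c x = 0.
  apply: (weighted_idempotent (w := w)); rewrite -?fK ?undup_uniq //.
  - by move=> x; exact/commr_sym.
  - move=> k; pose pairs := [seq (x, y) | x <- K, y <- K].
    have := @component_indexed _ pairs (fun p => p.1 * p.2)%g
      (fun p => c p.1 * c p.2) k.
    rewrite big_allpairs -big_distrlr /= -fK ff big_mkcond big_allpairs /= -/c.
    move=> ->.
      by apply: eq_bigr => x _; rewrite [RHS]big_mkcond.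
    by move=> p; case: gV => _ _; apply; exact: componentV.
  - move=> x y cx cy; rewrite mem_undup; apply/and_comm; split.
    by apply: wM; rewrite mem_cat ?sP ?cx ?cy ?allpairs_f ?sP ?orbT.
  by rewrite mem_cat allpairs_f ?sP ?orbT.
(* The vanishing sum [cz] collects distinct degrees, [z] among them, so each of
   its terms vanishes. *)
move/eqP: fz; apply.
have := @component_indexed G [seq x <- K | w x == w z] id c z (componentV f).
rewrite big_filter cz component0 => ->; rewrite big_filter_cond.
rewrite (eq_bigl (fun x => x == z)) ?big_pred1_uniq ?undup_uniq ?mem_undup //.
by move=> x; case: (x =P z) => [->|_]; rewrite ?eqxx ?andbF.
Qed.

End Graded.

(** * Crystalline graded rings *)

Section Crystalline.
Variables (G : groupType) (R : pzRingType) (A : set R) (u : G -> R).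
Hypothesis AG : crystalline_graded A u.
Let V := crystalline_part A u.

Lemma coefM a b : A a -> A b -> A (a * b).
Proof.
by case: (cg_subring AG) => _ _ AM Aa Ab; have := AM a b; rewrite !inE; apply.
Qed.

Lemma crystalline_part_u g : V g (u g).
Proof.
exists 1; last by rewrite mul1r.
by case: (cg_subring AG) => A1 _ _; rewrite inE in A1.
Qed.

Lemma alphaP g h : A (alpha A u g h) /\ u g * u h = alpha A u g h * u (g * h)%g.
Proof.
have [_ _ VM] := cg_graded AG.
have [a Aa au] := VM g h _ _ (crystalline_part_u g) (crystalline_part_u h).
rewrite /alpha; case: xgetP => [b -> //|/(_ a)].
by case; split; rewrite ?au.
Qed.

(** Multiplying [u_g a u_h = 0] on the left by the [u] of the inverse of [g] gives
    [alpha(g^-1, g) a u_h = 0], and [a = 0] since there is no torsion. *)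
Lemma mul_u_eq0 g h x : V h x -> u g * x = 0 -> x = 0.
Proof.
case=> a Aa <- /(congr1 ( *%R (u g^-1%g))).
have [Aal] := alphaP (g^-1)%g g; rewrite mulVg (cg_u1 AG) mulr1 => uu.
rewrite mulr0 mulrA uu mulrA => /(cg_free AG (coefM Aal Aa)).
rewrite -{2}[g]invgK => /(cg_torsion AG Aa) ->.
by rewrite mul0r.
Qed.

(** With [h = g^-1], the component of degree [h x] of [u_h f = f u_h] is
    [u_h f_x] on one side and [f_y u_h] on the other, where [y = x ^ g]. *)
Lemma central_component_conj f : (forall x, GRing.comm f x) ->
  forall x g, component V f x != 0 -> component V f (x ^ g)%g != 0.
Proof.
move=> fC x g cx; have gV := cg_graded AG; pose h := (g^-1)%g.
have [s [us sP fE]] := component_support gV f; rewrite -sP in cx.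
set c := component V f in sP fE *.
have VM := let: And3 _ _ H := gV in H.
have Vc y : V y (c y) by exact: componentV.
have uh := crystalline_part_u h.
have := fC (u h); rewrite /GRing.comm {1 2}fE mulr_suml mulr_sumr => E.
have L := component_indexed gV s (h * x)%g (fun y => VM _ _ _ _ (Vc y) uh).
have Rr := component_indexed gV s (h * x)%g (fun y => VM _ _ _ _ uh (Vc y)).
move: L; rewrite E Rr => {E Rr}.
rewrite (eq_bigl (fun y => y == x)) ?big_pred1_uniq //; last first.
  by move=> y; rewrite (inj_eq (mulgI h)).
move=> E; move: cx; rewrite sP; apply: contraNneq => cxg; apply/eqP.
apply: (mul_u_eq0 (g := h) (Vc x)); rewrite E big1 // => y /eqP yh.
suff -> : y = (x ^ g)%g by rewrite cxg mul0r.
by rewrite conjgE mulgA -/h -yh /h mulgVK.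
Qed.

End Crystalline.

Theorem corollary2p2 (G : groupType) (R : pzRingType) (A : set R) (u : G -> R)
    (AG : crystalline_graded A u) :
  (forall f : R, f != 0 -> central_idempotent f ->
     finite_set (support_group (crystalline_part A u) f)) /\
  (torsion_free G -> forall f : R, central_idempotent f -> A f).
Proof.
have gV := cg_graded AG.
have tors f : central_idempotent f -> forall x,
    component (crystalline_part A u) f x != 0 -> finite_order x.
  move=> cf; apply: (central_idempotent_torsion gV cf).
  exact: (central_component_conj AG cf.1).
split=> [f _ cf|tfG f cf].
  have [s [_ sP _]] := component_support gV f.
  have -> : support_group (crystalline_part A u) f
      = subgroup_generated [set` s].
    by congr subgroup_generated; apply/seteqP; split=> x; rewrite /Supp /= sP.
  apply: torsion_gen_finite => x.
    by move=> y; rewrite !sP => cx _; exact: (central_component_conj AG cf.1).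
  by rewrite sP; exact: tors.
have [_ _ fE] := componentP gV f.
have c0 x : x \notin [:: 1%g] -> component (crystalline_part A u) f x = 0.
  rewrite inE => x1; apply/eqP; apply: contraNT x1 => /(tors f cf)[n n0 xn].
  exact/eqP/(tfG x n).
rewrite (fsum_setT _ c0) // big_seq1 in fE.
by rewrite -(cg_part1 AG) fE; exact: componentV.
Qed.
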